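(* Assume that $\tilde{\mathcal S}$ is a convex projection. A unique sliding vector field is defined on the codimension-2 discontinuity $\Lambda$ (at $(x,0,0)$) of the piecewise smooth system $(X_1,X_2,X_3,X_4)$ if and only if both of the following hold: $$\det(\tilde X_1\ \tilde X_2)\,\det(\tilde X_3\ \tilde X_4)>0,$$ $$\det(\tilde X_2\ \tilde X_3)\,\det(\tilde X_4\ \tilde X_1)>0.$$
   Context: Setting. Let $\mathcal U\subset\mathbb R^3$ with coordinates $(x,y,z)$, $\mathcal I$ an interval, $\Lambda=\{(x,0,0):x\in\mathcal I\}$, $\mathcal Q_1=\{y\ge0,z\ge0\}$, $\mathcal Q_2=\{y\le0,z\ge0\}$, $\mathcal Q_3=\{y\le0,z\le0\}$, $\mathcal Q_4=\{y\ge0,z\le0\}$. The piecewise smooth system is $(\dot x,\dot y,\dot z)^T=X_i$ on $\mathcal Q_i$ with smooth $X_i=(\alpha_i,\beta_i,\gamma_i)^T$; standing assumption: $\alpha_i,\beta_i,\gamma_i$ depend only on $x$. Fix $x\in\mathcal I$ and let $\tilde X_i=(\beta_i,\gamma_i)^T\in\mathbb R^2$ be evaluated at $x$. $\det(a\ b)$ is the determinant of the matrix with columns $a,b$. For $(\psi,\phi)\in(-1,1)^2$ let $$\tilde F_x(\psi,\phi)=\tfrac12\Big(\tfrac{\tilde X_1}{2}(1+\phi)+\tfrac{\tilde X_4}{2}(1-\phi)\Big)(1+\psi)+\tfrac12\Big(\tfrac{\tilde X_2}{2}(1+\phi)+\tfrac{\tilde X_3}{2}(1-\phi)\Big)(1-\psi),$$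 and $\tilde{\mathcal S}=\tilde F_x((-1,1)^2)$. Sliding. Sliding vector fields at $(x,0,0)$ correspond to zeros $(\psi_*,\phi_* )\in(-1,1)^2$ of $\tilde F_x$: with $\sigma_\psi=(1+\psi_* )/2$, $\sigma_\phi=(1+\phi_* )/2$, the sliding vector field has $x$-component $\sigma_\psi\sigma_\phi\alpha_1+(1-\sigma_\psi)\sigma_\phi\alpha_2+(1-\sigma_\psi)(1-\sigma_\phi)\alpha_3+\sigma_\psi(1-\sigma_\phi)\alpha_4$ and vanishing $y,z$-components. ''Unique'' means exactly one such zero. Projection type. With indices mod 4, let $\chi_i=\tilde X_{i+1}-\tilde X_i$ and $\delta_i=\det(\chi_i\ \chi_{i+1})$, $i=1,2,3,4$. $\tilde{\mathcal S}$ is a convex projection if $\delta_1,\delta_2,\delta_3,\delta_4$ are all (nonzero and) of the same sign. *)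

(* Defs.v *)
From mathcomp Require Import all_boot all_order all_algebra.
From mathcomp Require Import all_classical all_reals all_analysis.

Set Implicit Arguments.
Unset Strict Implicit.
Unset Printing Implicit Defensive.

Import Order.TTheory GRing.Theory Num.Theory.
Import numFieldNormedType.Exports.

Local Open Scope classical_set_scope.
Local Open Scope ring_scope.

Section Smooth.
Context {R : realType} {V W : normedModType R}.

Definition iter_deriv (vs : seq V) (f : V -> W) : V -> W :=
  foldr (fun v g => fun p => 'D_v g p) f vs.

(* [A] need not be open: [f] is smooth on [A] when it is the restriction to [A]
   of a map whose iterated directional derivatives of all orders exist and are
   differentiable on an open set containing [A]. *)
Definition smooth_on (A : set V) (f : V -> W) : Prop :=
  exists (O : set V) (g : V -> W),
    [/\ open O, A `<=` O,
        forall p, A p -> g p = f p &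
        forall (vs : seq V) p, O p -> differentiable (iter_deriv vs g) p].

End Smooth.

Section PiecewiseSmooth.
Context {R : realType}.

Definition vec2 (b c : R) : 'cV[R]_2 := \col_(j < 2) [:: b; c]`_j.
Definition vec3 (a b c : R) : 'cV[R]_3 := \col_(j < 3) [:: a; b; c]`_j.

Definition xcoord (p : 'cV[R]_3) : R := p 0 0.
Definition ycoord (p : 'cV[R]_3) : R := p 1 0.
Definition zcoord (p : 'cV[R]_3) : R := p 2 0.

Definition det2 (a b : 'cV[R]_2) : R := \det (row_mx a b : 'M[R]_2).

Definition Lambda (I : interval R) : set 'cV[R]_3 :=
  [set vec3 x 0 0 | x in [set` I]].

(* The indices 1, 2, 3, 4 are residues modulo 4, so that [4 = 0] in ['Z_4] and
   the last branch is the quadrant of index 4. *)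
Definition quadrant (i : 'Z_4) : set 'cV[R]_3 :=
  match val i with
  | 1%N => [set p | 0 <= ycoord p /\ 0 <= zcoord p]
  | 2%N => [set p | ycoord p <= 0 /\ 0 <= zcoord p]
  | 3%N => [set p | ycoord p <= 0 /\ zcoord p <= 0]
  | _ => [set p | 0 <= ycoord p /\ zcoord p <= 0]
  end.

End PiecewiseSmooth.

(* The values of [vfield i] outside [dom `&` quadrant i] are irrelevant. *)
Record pws_system (R : realType) := PwsSystem {
  dom : set 'cV[R]_3;
  xrange : interval R;
  Lambda_dom : Lambda xrange `<=` dom;
  vfield : 'Z_4 -> 'cV[R]_3 -> 'cV[R]_3;
  vfield_smooth : forall i, smooth_on (dom `&` quadrant i) (vfield i);
  vfield_xonly : forall i p q, (dom `&` quadrant i) p -> (dom `&` quadrant i) q ->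
    xcoord p = xcoord q -> vfield i p = vfield i q
}.

Section Sliding.
Context {R : realType}.
Variables (S : pws_system R) (x : R).

Definition alpha (i : 'Z_4) : R := xcoord (vfield S i (vec3 x 0 0)).
Definition beta (i : 'Z_4) : R := ycoord (vfield S i (vec3 x 0 0)).
Definition gamma (i : 'Z_4) : R := zcoord (vfield S i (vec3 x 0 0)).

Definition tX (i : 'Z_4) : 'cV[R]_2 := vec2 (beta i) (gamma i).

Definition tF (psi phi : R) : 'cV[R]_2 :=
  ((1 + psi) / 2) *: (((1 + phi) / 2) *: tX 1 + ((1 - phi) / 2) *: tX 4)
  + ((1 - psi) / 2) *: (((1 + phi) / 2) *: tX 2 + ((1 - phi) / 2) *: tX 3).

Definition sliding_vector (psi phi : R) : 'cV[R]_3 :=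
  let spsi := (1 + psi) / 2 in
  let sphi := (1 + phi) / 2 in
  vec3 (spsi * sphi * alpha 1 + (1 - spsi) * sphi * alpha 2
        + (1 - spsi) * (1 - sphi) * alpha 3 + spsi * (1 - sphi) * alpha 4)
       0 0.

Definition sliding_vf (psi phi : R) (v : 'cV[R]_3) : Prop :=
  [/\ -1 < psi < 1, -1 < phi < 1, tF psi phi = 0 & v = sliding_vector psi phi].

(* A sliding vector field is counted together with the zero of [tF] defining it:
   two distinct zeros are not identified even when they give the same vector. *)
Definition unique_sliding_vf : Prop :=
  exists! s : (R * R) * 'cV[R]_3, sliding_vf s.1.1 s.1.2 s.2.

(* The image of the open square under [tF] is governed by the closed quadrilateral
   [tX 1, tX 2, tX 3, tX 4]: [chi i] are its consecutive edges and [convex_projection]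
   says that it always turns strictly in the same direction. *)
Definition chi (i : 'Z_4) : 'cV[R]_2 := tX (i + 1) - tX i.
Definition delta (i : 'Z_4) : R := det2 (chi i) (chi (i + 1)).

Definition convex_projection : Prop :=
  (forall i, 0 < delta i) \/ (forall i, delta i < 0).

End Sliding.

(* Main.v *)
(** Call A, B, C, D the four projected vectors.  The convexity hypothesis says
    that ABCD is a strictly convex quadrilateral, and the two determinant
    conditions turn out to mean that the origin lies strictly on the inner side
    of its four edges.  That is necessary, since a zero of the bilinear map is a
    convex combination of A, B, C, D with positive weights.  Conversely, a zero
    with parameters (s, t) amounts to the origin dividing the segment from
    P = sA + (1-s)B to Q = sD + (1-s)C in the ratio (1-t) : t.  Collinearity of
    P, Q and the origin is a quadratic equation in s, which changes sign on
    [0, 1] and therefore has exactly one root there, and s determines t. *)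
Require Import Defs.
From mathcomp Require Import all_boot all_order all_algebra.
From mathcomp Require Import all_classical all_reals all_analysis.
From mathcomp Require Import ring lra.

Import Order.TTheory GRing.Theory Num.Theory.
Import numFieldNormedType.Exports.

Local Open Scope classical_set_scope.
Local Open Scope ring_scope.

(** * Quadratics with a sign change on the unit interval *)

Lemma quadratic_root_exists (R : rcfType) (a b c : R) :
  0 < c -> a + b + c < 0 -> exists2 s, 0 < s < 1 & a * s ^+ 2 + b * s + c = 0.
Proof.
move=> c0 abc0.
(* The sign is flipped because [poly_ivt] wants a value at most 0 on the left and at least 0 on the
   right. *)
pose p : {poly R} := - (a *: 'X^2 + b *: 'X + c%:P).
have pE s : p.[s] = - (a * s ^+ 2 + b * s + c) by rewrite !hornerE.
have [|s /andP[s0 s1] /rootP] := @poly_ivt _ p 0 1 ler01.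
  by rewrite !pE; apply/andP; split; lra.
rewrite pE => /eqP; rewrite oppr_eq0 => /eqP ps.
exists s => //; rewrite !lt_neqAle s0 s1 !andbT.
apply/andP; split; apply/eqP => sE; move: ps.
  by rewrite -sE expr0n /= !mulr0 !add0r => cE; rewrite cE ltxx in c0.
by rewrite sE expr1n !mulr1 => cE; rewrite cE ltxx in abc0.
Qed.

(* If s != s' were both roots, then c = a s s' and a + b + c = a (1-s)(1-s')
   would have the same sign. *)
Lemma quadratic_root_unique (R : realFieldType) (a b c s s' : R) :
  0 < c -> a + b + c < 0 -> 0 < s < 1 -> 0 < s' < 1 ->
  a * s ^+ 2 + b * s + c = 0 -> a * s' ^+ 2 + b * s' + c = 0 -> s = s'.
Proof.
move=> c0 abc0 /andP[s0 s1] /andP[s'0 s'1] e e'.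
apply/eqP; rewrite -subr_eq0; apply/negPn/negP => ss'.
have bE : b = - a * (s + s').
  apply: (mulfI ss'); apply/eqP; rewrite -subr_eq0; apply/eqP.
  by transitivity ((a * s ^+ 2 + b * s + c) - (a * s' ^+ 2 + b * s' + c));
    [ring | rewrite e e' subrr].
have cE : c = a * (s * s') by rewrite -[LHS]addr0 -oppr0 -e bE; ring.
have ss'0 : 0 < s * s' by rewrite mulr_gt0.
have a0 : 0 < a by rewrite -(pmulr_lgt0 _ ss'0) -cE.
have : 0 < a * ((1 - s) * (1 - s')) by rewrite !mulr_gt0 ?subr_gt0.
have -> : a * ((1 - s) * (1 - s')) = a + b + c by rewrite bE cE; ring.
by lra.
Qed.

(* In terms of the doubled signed areas [0AB], [0BC], [0CD], [0DA] (p, q, r, u) and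
   det (A C), det (B D) (m, n), the hypotheses are the positivity of the four
   corner triangles and the Pluecker relation. *)
Lemma opposite_signs_absurd (R : realFieldType) (p q r u m n : R) :
  0 < p + q - m -> 0 < q + r - n -> 0 < r + u + m -> 0 < u + p + n ->
  p * r - u * q = m * n -> 0 < p -> 0 < r -> q < 0 -> u < 0 -> False.
Proof.
move=> h1 h2 h3 h4 pl p0 r0 q0 u0.
(* In each sign case the bounds on [m] and [n] force [m * n < p * r - u * q], against [pl]. *)
by have [m0|m0] := lerP 0 m; have [n0|n0] := lerP 0 n; nra.
Qed.

(** * Planar determinants *)

Lemma det2E (R : realType) (a b : 'cV[R]_2) :
  det2 a b = a 0 0 * b 1 0 - a 1 0 * b 0 0.
Proof.
rewrite /det2 (expand_det_row _ 0) !big_ord_recl big_ord0 /cofactor !det_mx11.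
have h1 : lift 0 0 = 1 :> 'I_2 by exact/val_inj.
have h10 : lift 1 0 = 0 :> 'I_2 by exact/val_inj.
have s0 : fintype.split (0 : 'I_(1 + 1)) = inl 0.
  by rewrite -[RHS]unsplitK; congr fintype.split; exact/val_inj.
have s1 : fintype.split (1 : 'I_(1 + 1)) = inr 0.
  by rewrite -[RHS]unsplitK; congr fintype.split; exact/val_inj.
by rewrite !mxE ?h1 ?h10 s0 s1 /= add0n expr0 expr1; ring.
Qed.

(** Cramer's identity: det (a v) w - det (a w) v = - det (v w) a. *)
Lemma det2_dependent (R : realType) (e : R) (a v w : 'cV[R]_2) :
  e * det2 v w = 0 -> (e * det2 a v) *: w = (e * det2 a w) *: v.
Proof.
move=> vw0; apply/matrixP => i j; rewrite (ord1 j) {j} !mxE.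
apply/eqP; rewrite -subr_eq0 -[X in _ == X](mul0r (- a i 0)) -vw0.
have /orP[/eqP ->|/eqP ->] : (i == 0) || (i == 1) by case: i => -[|[|]].
  by apply/eqP; rewrite !det2E; ring.
by apply/eqP; rewrite !det2E; ring.
Qed.

(** * Position of the origin relative to the four edges *)

Definition bilin_point {R : realType} (A B C D : 'cV[R]_2) (s t : R) : 'cV[R]_2 :=
  s *: (t *: A + (1 - t) *: D) + (1 - s) *: (t *: B + (1 - t) *: C).

(* [e] selects the orientation: only its sign matters. *)
Definition convex_quad {R : realType} (e : R) (A B C D : 'cV[R]_2) : Prop :=
  [/\ 0 < e * det2 (B - A) (C - B), 0 < e * det2 (C - B) (D - C),
      0 < e * det2 (D - C) (A - D) & 0 < e * det2 (A - D) (B - A)].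

Definition origin_inside {R : realType} (e : R) (A B C D : 'cV[R]_2) : Prop :=
  [/\ 0 < e * det2 A B, 0 < e * det2 B C, 0 < e * det2 C D & 0 < e * det2 D A].

Lemma origin_inside_of_zero (R : realType) (e : R) (A B C D : 'cV[R]_2) (s t : R) :
  convex_quad e A B C D -> 0 < s < 1 -> 0 < t < 1 ->
  bilin_point A B C D s t = 0 -> origin_inside e A B C D.
Proof.
move=> [d1 d2 d3 d4] /andP[s0 s1] /andP[t0 t1] F0.
have s'0 : 0 < 1 - s by rewrite subr_gt0.
have t'0 : 0 < 1 - t by rewrite subr_gt0.
(* Here [w] is the oriented doubled area of the triangle on the edge uv with apex the bilinear
   point. It averages the areas with apex at each vertex, so only the two vertices off the edge
   contribute, each through a corner triangle. *)
have edge u v w : e * det2 u v = w - e * det2 (v - u) (bilin_point A B C D s t) ->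
    0 < w -> 0 < e * det2 u v.
  by move=> ->; rewrite F0 (det2E _ _ 0) !mxE !mulr0 subrr mulr0 subr0.
split.
- apply: (edge _ _ ((1 - s) * (1 - t) * (e * det2 (B - A) (C - B))
    + s * (1 - t) * (e * det2 (A - D) (B - A)))); last first.
  by apply: addr_gt0; apply: mulr_gt0 => //; exact: mulr_gt0.
  by rewrite !det2E !mxE; ring.
- apply: (edge _ _ (s * (1 - t) * (e * det2 (C - B) (D - C))
    + s * t * (e * det2 (B - A) (C - B)))); last first.
  by apply: addr_gt0; apply: mulr_gt0 => //; exact: mulr_gt0.
  by rewrite !det2E !mxE; ring.
- apply: (edge _ _ (s * t * (e * det2 (D - C) (A - D))
    + (1 - s) * t * (e * det2 (C - B) (D - C)))); last first.
  by apply: addr_gt0; apply: mulr_gt0 => //; exact: mulr_gt0.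
  by rewrite !det2E !mxE; ring.
- apply: (edge _ _ ((1 - s) * t * (e * det2 (A - D) (B - A))
    + (1 - s) * (1 - t) * (e * det2 (D - C) (A - D)))); last first.
  by apply: addr_gt0; apply: mulr_gt0 => //; exact: mulr_gt0.
  by rewrite !det2E !mxE; ring.
Qed.

(** The products leave four sign patterns for the edge areas. All negative is impossible since their
    sum is the area of the quadrilateral; the two mixed patterns fall to [opposite_signs_absurd]. *)
Lemma origin_inside_of_signs (R : realType) (e : R) (A B C D : 'cV[R]_2) :
  convex_quad e A B C D -> 0 < det2 A B * det2 C D -> 0 < det2 B C * det2 D A ->
  origin_inside e A B C D.
Proof.
move=> [d1 d2 d3 d4] pr qu.
have e2 : 0 < e ^+ 2.
  rewrite exprn_even_gt0 //=; apply/eqP => e0.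
  by move: d1; rewrite e0 mul0r ltxx.
have {}pr : 0 < (e * det2 A B) * (e * det2 C D).
  by rewrite mulrACA -expr2 mulr_gt0.
have {}qu : 0 < (e * det2 B C) * (e * det2 D A).
  by rewrite mulrACA -expr2 mulr_gt0.
have {}d1 : 0 < e * det2 A B + e * det2 B C - e * det2 A C.
  by move: d1; congr (0 < _); rewrite !det2E !mxE; ring.
have {}d2 : 0 < e * det2 B C + e * det2 C D - e * det2 B D.
  by move: d2; congr (0 < _); rewrite !det2E !mxE; ring.
have {}d3 : 0 < e * det2 C D + e * det2 D A + e * det2 A C.
  by move: d3; congr (0 < _); rewrite !det2E !mxE; ring.
have {}d4 : 0 < e * det2 D A + e * det2 A B + e * det2 B D.
  by move: d4; congr (0 < _); rewrite !det2E !mxE; ring.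
have pl : (e * det2 A B) * (e * det2 C D) - (e * det2 D A) * (e * det2 B C)
    = (e * det2 A C) * (e * det2 B D) by rewrite !det2E; ring.
have := opposite_signs_absurd _ _ _ _ _ _ _ d1 d2 d3 d4 pl.
(* The other mixed pattern: relabelling A, B, C, D as B, C, D, A turns (m, n) into (n, -m). *)
have := opposite_signs_absurd _ (e * det2 B C) (e * det2 C D) (e * det2 D A) (e * det2 A B)
  (e * det2 B D) (- (e * det2 A C)).
rewrite /origin_inside.
move: (e * det2 A B) (e * det2 B C) (e * det2 C D) (e * det2 D A)
  (e * det2 A C) (e * det2 B D) d1 d2 d3 d4 pr qu pl => p q r u m n.
move=> d1 d2 d3 d4 pr qu pl H2 H1.
have [p0|p0|p0] := ltgtP p 0; last by rewrite p0 mul0r ltxx in pr.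
- have r0 : r < 0 by rewrite -(nmulr_rgt0 _ p0).
  have [q0|q0|q0] := ltgtP q 0; last by rewrite q0 mul0r ltxx in qu.
  + have u0 : u < 0 by rewrite -(nmulr_rgt0 _ q0).
    by exfalso; lra.
  + have u0 : 0 < u by rewrite -(pmulr_rgt0 _ q0).
    by exfalso; apply: H2 => //; lra.
- have r0 : 0 < r by rewrite -(pmulr_rgt0 _ p0).
  have [q0|q0|q0] := ltgtP q 0; last by rewrite q0 mul0r ltxx in qu.
  + have u0 : u < 0 by rewrite -(nmulr_rgt0 _ q0).
    by exfalso; apply: H1.
  + by have u0 : 0 < u by rewrite -(pmulr_rgt0 _ q0).
Qed.

(** * Zeros of the bilinear map *)

Lemma collinearityE (R : realType) (e s : R) (A B C D : 'cV[R]_2) :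
  e * det2 (s *: A + (1 - s) *: B) (s *: D + (1 - s) *: C)
  = (e * (det2 A D - det2 A C - det2 B D + det2 B C)) * s ^+ 2
    + (e * (det2 A C + det2 B D - 2 * det2 B C)) * s + e * det2 B C.
Proof. by rewrite !det2E !mxE; ring. Qed.

Lemma bilin_pointE (R : realType) (s t : R) (A B C D : 'cV[R]_2) :
  bilin_point A B C D s t =
  t *: (s *: A + (1 - s) *: B) + (1 - t) *: (s *: D + (1 - s) *: C).
Proof. by apply/matrixP => i j; rewrite !mxE; ring. Qed.

(* The distance of Q from the line AB, up to a positive factor. *)
Local Notation height e s A B C D :=
  (s * (e * det2 (A - D) (B - A)) + (1 - s) * (e * det2 (B - A) (C - B))).

(** P lies on the line AB, so the distance from AB to the point dividing PQ is [1 - t] times that of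
    Q. Hence [s] determines [t]. *)
Lemma bilin_point_zero_t (R : realType) (e s t : R) (A B C D : 'cV[R]_2) :
  bilin_point A B C D s t = 0 -> (1 - t) * height e s A B C D = e * det2 A B.
Proof.
move=> F0.
transitivity (e * det2 A B + e * det2 (B - A) (bilin_point A B C D s t)).
  by rewrite bilin_pointE !det2E !mxE; ring.
by rewrite F0 (det2E _ _ 0) !mxE !mulr0 subrr mulr0 addr0.
Qed.

Lemma bilin_point_zero_s (R : realType) (s t : R) (A B C D : 'cV[R]_2) :
  bilin_point A B C D s t = 0 ->
  det2 (s *: A + (1 - s) *: B) (s *: D + (1 - s) *: C) = 0.
Proof.
rewrite bilin_pointE; set P := _ + _ *: B; set Q := _ + _ *: C => F0.
(* The first two terms are (1 - t) det (P Q) and t det (P Q), so nothing has to be divided by [t] or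
   [1 - t]. *)
transitivity (det2 P (t *: P + (1 - t) *: Q) - det2 Q (t *: P + (1 - t) *: Q)
  + (1 - t - t) * 0 + 0 * det2 P Q).
  by rewrite !det2E; move: P Q {F0} => P Q; rewrite !mxE; ring.
by rewrite F0 !(det2E _ _ 0) !mxE; ring.
Qed.

Section ConvexQuad.
Context {R : realType} (e : R) (A B C D : 'cV[R]_2).
Context (cvx : convex_quad e A B C D) (inside : origin_inside e A B C D).

(** The quadratic of [collinearityE] takes the values [0BC] at s = 0 and -[0DA] at s = 1. *)
Let collinearity0 : 0 < e * det2 B C. Proof. by case: inside. Qed.

Let collinearity1 :
  e * (det2 A D - det2 A C - det2 B D + det2 B C)
  + e * (det2 A C + det2 B D - 2 * det2 B C) + e * det2 B C < 0.
Proof.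
case: inside => _ _ _; rewrite -oppr_lt0; congr (_ < 0).
by rewrite !det2E; ring.
Qed.

Let height_gt0 s : 0 < s < 1 -> 0 < height e s A B C D.
Proof.
case: cvx => d1 _ _ d4 /andP[s0 s1].
by apply: addr_gt0; apply: mulr_gt0; rewrite ?subr_gt0.
Qed.

Lemma bilin_point_zero_unique s t s' t' :
  0 < s < 1 -> 0 < s' < 1 ->
  bilin_point A B C D s t = 0 -> bilin_point A B C D s' t' = 0 ->
  s = s' /\ t = t'.
Proof.
move=> hs hs' F0 F0'.
have ss' : s = s'.
  apply: (quadratic_root_unique _ _ _ _ _ _ collinearity0 collinearity1 hs hs');
    rewrite -collinearityE.
    by rewrite (bilin_point_zero_s _ _ _ _ _ _ _ F0) mulr0.
  by rewrite (bilin_point_zero_s _ _ _ _ _ _ _ F0') mulr0.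
split=> //; rewrite -{s' hs'}ss' in F0'.
have /lt0r_neq0 h0 := height_gt0 s hs.
have := bilin_point_zero_t _ e _ _ _ _ _ _ F0.
rewrite -(bilin_point_zero_t _ e _ _ _ _ _ _ F0') => /(mulIf h0) /eqP.
by rewrite (inj_eq (addrI _)) eqr_opp => /eqP.
Qed.

Lemma bilin_point_zero_exists :
  exists s t, [/\ 0 < s < 1, 0 < t < 1 & bilin_point A B C D s t = 0].
Proof.
have [s hs] := quadratic_root_exists _ _ _ _ collinearity0 collinearity1.
rewrite -collinearityE => PQ.
have h0 := height_gt0 s hs.
have hN0 := lt0r_neq0 h0.
exists s, (1 - e * det2 A B / height e s A B C D).
have [AB0 _ CD0 _] := inside; have [_ d2 d3 _] := cvx.
(* [0 = P + k (Q - P)], where k = [0AB] / height is positive; the analogous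
   formula from the opposite edge CD shows that 1 - k is positive. *)
set k := _ / _.
have k0 : 0 < k by rewrite divr_gt0.
set P := s *: A + (1 - s) *: B; set Q := s *: D + (1 - s) *: C.
have PQ0 : P + k *: (Q - P) = 0.
  have PQ' : e * det2 P (Q - P) = 0 by rewrite -PQ !det2E !mxE; ring.
  have PE : e * det2 (B - A) P = - (e * det2 A B) by rewrite !det2E !mxE; ring.
  have QE : e * det2 (B - A) (Q - P) = height e s A B C D.
    by rewrite !det2E !mxE; ring.
  (* P and Q - P are parallel; their determinants with the edge B - A give the ratio -[0AB] :
     height. *)
  have := det2_dependent _ _ (B - A) _ _ PQ'; rewrite PE QE scaleNr => T.
  apply: (scalerI hN0); rewrite [LHS]scalerDr -T scaler0 scalerA.
  by rewrite /k [_ * (_ / _)]mulrC divfK // addNr.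
have F0 : bilin_point A B C D s (1 - k) = 0.
  rewrite bilin_pointE -/P -/Q -[RHS]PQ0.
  by apply/matrixP => i j; rewrite !mxE; ring.
split=> //.
have s'0 : 0 < 1 - s by case/andP: hs; rewrite subr_gt0.
have {}hs : 0 < s by case/andP: hs.
have g0 : 0 < s * (e * det2 (D - C) (A - D)) + (1 - s) * (e * det2 (C - B) (D - C)).
  by apply: addr_gt0; exact: mulr_gt0.
have gE : (1 - k) * (s * (e * det2 (D - C) (A - D)) + (1 - s) * (e * det2 (C - B) (D - C)))
   = e * det2 C D.
  transitivity (e * det2 C D + e * det2 (D - C) (bilin_point A B C D s (1 - k))).
    by rewrite bilin_pointE !det2E !mxE; ring.
  by rewrite F0 (det2E _ _ 0) !mxE !mulr0 subrr mulr0 addr0.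
apply/andP; split; last by rewrite ltrBlDr ltrDl.
by rewrite -(pmulr_lgt0 _ g0) gE.
Qed.

End ConvexQuad.

(** * Back to the piecewise smooth system *)

Lemma convex_projection_quad (R : realType) (S : pws_system R) (x : R) :
  convex_projection S x ->
  exists e, convex_quad e (tX S x 1) (tX S x 2) (tX S x 3) (tX S x 4).
Proof.
have E2 : (1 + 1 : 'Z_4) = 2 by exact/val_inj.
have E3 : (2 + 1 : 'Z_4) = 3 by exact/val_inj.
have E4 : (3 + 1 : 'Z_4) = 4 by exact/val_inj.
have E1 : (4 + 1 : 'Z_4) = 1 by exact/val_inj.
case=> h; [exists 1 | exists (-1)].
  by split; rewrite mul1r;
    [move: (h 1) | move: (h 2) | move: (h 3) | move: (h 4)];
    rewrite /delta /chi ?E1 ?E2 ?E3 ?E4 ?E1 ?E2.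
by split; rewrite mulN1r oppr_gt0;
  [move: (h 1) | move: (h 2) | move: (h 3) | move: (h 4)];
  rewrite /delta /chi ?E1 ?E2 ?E3 ?E4 ?E1 ?E2.
Qed.

Lemma tF_bilin_point (R : realType) (S : pws_system R) (x psi phi : R) :
  tF S x psi phi = bilin_point (tX S x 1) (tX S x 2) (tX S x 3) (tX S x 4)
    ((1 + psi) / 2) ((1 + phi) / 2).
Proof. by rewrite /tF /bilin_point; congr (_ *: (_ + _ *: _) + _ *: (_ + _ *: _)); lra. Qed.

Lemma half_unit_interval (R : realFieldType) (a : R) :
  (-1 < a < 1) = (0 < (1 + a) / 2 < 1).
Proof. by apply/idP/idP => /andP[? ?]; apply/andP; split; lra. Qed.

Theorem proposition3 (R : realType) (S : pws_system R) (x : R)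
    (hx : x \in xrange S) (hconv : convex_projection S x) :
  unique_sliding_vf S x <->
  (0 < det2 (tX S x 1) (tX S x 2) * det2 (tX S x 3) (tX S x 4)) /\
  (0 < det2 (tX S x 2) (tX S x 3) * det2 (tX S x 4) (tX S x 1)).
Proof.
have [e cvx] := convex_projection_quad _ _ _ hconv.
split.
  move=> [[[psi phi] v] [[/= hpsi hphi F0 _] _]].
  rewrite half_unit_interval in hpsi; rewrite half_unit_interval in hphi.
  rewrite tF_bilin_point in F0.
  have [p q r u] := origin_inside_of_zero _ _ _ _ _ _ _ _ cvx hpsi hphi F0.
  have e2 : 0 < e ^+ 2.
    rewrite exprn_even_gt0 //=; apply/eqP => e0.
    by move: p; rewrite e0 mul0r ltxx.
  by split; rewrite -(pmulr_rgt0 _ e2) expr2 mulrACA mulr_gt0.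
move=> [pr qu].
have inside := origin_inside_of_signs _ _ _ _ _ _ cvx pr qu.
have [s [t [hs ht F0]]] := bilin_point_zero_exists _ _ _ _ _ cvx inside.
have sE : (1 + (2 * s - 1)) / 2 = s by lra.
have tE : (1 + (2 * t - 1)) / 2 = t by lra.
(* Inverse of the substitution s = (1 + psi) / 2, t = (1 + phi) / 2. *)
exists ((2 * s - 1, 2 * t - 1), sliding_vector S x (2 * s - 1) (2 * t - 1)).
split; first by split; rewrite //= ?half_unit_interval ?tF_bilin_point ?sE ?tE.
move=> [[psi phi] v] [/=]; rewrite !half_unit_interval tF_bilin_point => hpsi hphi F0' ->.
have [-> ->] := bilin_point_zero_unique _ _ _ _ _ cvx inside _ _ _ _ hs hpsi F0 F0'.
have -> : 2 * ((1 + psi) / 2) - 1 = psi by lra.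
by have -> : 2 * ((1 + phi) / 2) - 1 = phi by lra.
Qed.
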